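(* Let $v\ge4$. As formal power series in $y$, \[1+\sum_{d=1}^\infty \sum_{D \in \mathcal{D}_{v,d}(132,321)} x^{des(\pi_D)}y^d = \frac{1-2y+y^2+vxy^2}{(1-y)^3}.\]
   Context: A diamond with $v$ vertices ($v\ge4$) is the poset with a least element, a greatest element, and $v-2$ pairwise incomparable middle elements (in a fixed left-to-right order) strictly between them. $\mathcal{D}_{v,d}$ is the set of labellings of $d$ diamonds (placed left to right) by $1,\dots,vd$, each label used once, such that in each diamond least label $<$ each middle label $<$ greatest label. For $D\in\mathcal{D}_{v,d}$, $\pi_D$ is the permutation obtained by reading the diamonds left to right and, within each diamond, the least element, then the middle elements left to right, then the greatest element. $\mathcal{D}_{v,d}(P)$ is the set of $D$ with $\pi_D$ avoiding every classical pattern in $P$. $des(\pi)$ is the number of $i$ with $\pi_i>\pi_{i+1}$. *)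

(* Defs.v *)
From HB Require Import structures.
From mathcomp Require Import all_boot all_order all_algebra.
From mathcomp Require Import boolp.

Set Implicit Arguments.
Unset Strict Implicit.
Unset Printing Implicit Defensive.

Import GRing.Theory.

(* Formal power series in one variable, with the Cauchy product. *)
Section FormalPowerSeries.
Local Open Scope ring_scope.

Record fps (R : Type) := Fps { fps_coef : nat -> R }.

Lemma fpsP (R : Type) (f g : fps R) : fps_coef f =1 fps_coef g <-> f = g.
Proof.
split=> [|-> //]; case: f g => f [g] /= fg.
by congr Fps; apply/boolp.funext.
Qed.

HB.instance Definition _ (R : Type) := gen_eqMixin (fps R).
HB.instance Definition _ (R : Type) := gen_choiceMixin (fps R).

Section Ring.
Variable R : comNzRingType.
Implicit Types f g h : fps R.

Definition fps_zero : fps R := Fps (fun=> 0).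
Definition fps_opp f : fps R := Fps (fun n => - fps_coef f n).
Definition fps_add f g : fps R := Fps (fun n => fps_coef f n + fps_coef g n).

Lemma fps_addA : associative fps_add.
Proof. by move=> f g h; apply/fpsP => n /=; rewrite addrA. Qed.

Lemma fps_addC : commutative fps_add.
Proof. by move=> f g; apply/fpsP => n /=; rewrite addrC. Qed.

Lemma fps_add0 : left_id fps_zero fps_add.
Proof. by move=> f; apply/fpsP => n /=; rewrite add0r. Qed.

Lemma fps_addN : left_inverse fps_zero fps_opp fps_add.
Proof. by move=> f; apply/fpsP => n /=; rewrite addNr. Qed.

HB.instance Definition _ :=
  GRing.isZmodule.Build (fps R) fps_addA fps_addC fps_add0 fps_addN.

Definition fpsC (c : R) : fps R := Fps (fun n => if n == 0%N then c else 0).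

Definition fps_mul f g : fps R :=
  Fps (fun n => \sum_(i < n.+1) fps_coef f i * fps_coef g (n - i)%N).

Definition fps_trunc (m : nat) f : {poly R} := \poly_(i < m) fps_coef f i.

Lemma coef_fps_mul m n f g : (n < m)%N ->
  fps_coef (fps_mul f g) n = (fps_trunc m f * fps_trunc m g)`_n.
Proof.
move=> nm; rewrite coefM /=; apply: eq_bigr => i _.
have le_in : (i <= n)%N by rewrite -ltnS.
rewrite !coef_poly (leq_ltn_trans le_in nm).
by rewrite (leq_ltn_trans (leq_subr _ _) nm).
Qed.

Lemma fps_mulC : commutative fps_mul.
Proof.
by move=> f g; apply/fpsP => n; rewrite !(coef_fps_mul _ _ (ltnSn n)) mulrC.
Qed.

Lemma fps_mulA : associative fps_mul.
Proof.
move=> f g h; apply/fpsP => n.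
transitivity ((fps_trunc n.+1 f * (fps_trunc n.+1 g * fps_trunc n.+1 h))`_n).
  rewrite coefM; apply: eq_bigr => i _.
  by rewrite coef_poly ltn_ord (@coef_fps_mul n.+1) // ltnS leq_subr.
rewrite mulrA coefM; apply: eq_bigr => i _.
by rewrite (@coef_fps_mul n.+1) // coef_poly ltnS leq_subr.
Qed.

Lemma fps_mul1 : left_id (fpsC 1) fps_mul.
Proof.
move=> f; apply/fpsP => n /=; rewrite big_ord_recl /= subn0 mul1r.
by rewrite big1 ?addr0 // => i _; rewrite mul0r.
Qed.

Lemma fps_mulDl : left_distributive fps_mul fps_add.
Proof.
move=> f g h; apply/fpsP => n /=; rewrite -big_split /=.
by apply: eq_bigr => i _; rewrite mulrDl.
Qed.

Lemma fps_oner_neq0 : fpsC 1 != 0.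
Proof.
by apply/eqP => /fpsP /(_ 0%N) /= /eqP; rewrite oner_eq0.
Qed.

HB.instance Definition _ := GRing.Zmodule_isComNzRing.Build (fps R)
  fps_mulA fps_mulC fps_mul1 fps_mulDl fps_oner_neq0.

Definition fpsY : fps R := Fps (fun n => if n == 1%N then 1 else 0).

End Ring.

Section UnitRing.
Variable R : comUnitRingType.
Implicit Types f g : fps R.

Definition fps_unit : pred (fps R) := fun f => fps_coef f 0 \is a GRing.unit.

(* The first n.+1 coefficients of the reciprocal f^-1, from
   f_0 g_0 = 1 and f_0 g_n = - \sum_(i < n) f_(n - i) g_i. *)
Fixpoint fps_inv_seq f (n : nat) : seq R :=
  if n is m.+1 then
    let s := fps_inv_seq f m in
    rcons s (- (fps_coef f 0)^-1 * \sum_(i < m.+1) fps_coef f (m.+1 - i) * s`_i)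
  else [:: (fps_coef f 0)^-1].

Definition fps_inv f : fps R :=
  if fps_unit f then Fps (fun n => (fps_inv_seq f n)`_n) else f.

Lemma size_fps_inv_seq f n : size (fps_inv_seq f n) = n.+1.
Proof. by elim: n => //= n IHn; rewrite size_rcons IHn. Qed.

Lemma nth_fps_inv_seq f n i : (i <= n)%N ->
  (fps_inv_seq f n)`_i = (fps_inv_seq f i)`_i.
Proof.
elim: n => [|n IHn]; first by rewrite leqn0 => /eqP->.
rewrite leq_eqVlt => /predU1P[-> //|]; rewrite ltnS => le_in /=.
by rewrite nth_rcons size_fps_inv_seq ltnS le_in IHn.
Qed.

Lemma fps_mulV : {in fps_unit, left_inverse 1 fps_inv *%R}.
Proof.
move=> f; rewrite unfold_in => uf; apply/fpsP => n.
rewrite /fps_inv /fps_unit uf; case: n => [|n] /=.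
  by rewrite big_ord_recl big_ord0 addr0 mulVr.
rewrite big_ord_recr /= subnn nth_rcons size_fps_inv_seq ltnn eqxx.
rewrite mulrC mulNr mulrN mulVKr //; apply/eqP; rewrite subr_eq0; apply/eqP.
by apply: eq_bigr => i _; rewrite mulrC (@nth_fps_inv_seq f n) // -ltnS.
Qed.

Lemma fps_unitP f g : g * f = 1 -> fps_unit f.
Proof.
move/fpsP/(_ 0%N) => /=; rewrite big_ord_recl big_ord0 addr0 /= => gf1.
by apply/unitrPr; exists (fps_coef g 0); rewrite mulrC.
Qed.

Lemma fps_inv_out : {in [predC fps_unit], fps_inv =1 id}.
Proof. by move=> f; rewrite inE unfold_in /fps_inv /fps_unit => /negbTE ->. Qed.

HB.instance Definition _ := GRing.ComNzRing_hasMulInverse.Build (fps R)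
  fps_mulV fps_unitP fps_inv_out.

End UnitRing.
End FormalPowerSeries.

(* Permutations are words in one-line notation. *)
Section Words.
Implicit Types s p : seq nat.

Definition des s : nat :=
  #|[set i : 'I_(size s).-1 | nth 0 s i > nth 0 s i.+1]|.

Definition contains s p : bool :=
  [exists f : {ffun 'I_(size p) -> 'I_(size s)},
    [forall i : 'I_(size p), forall j : 'I_(size p), (i < j) ==> (f i < f j)] &&
    [forall i : 'I_(size p), forall j : 'I_(size p),
      (nth 0 p i < nth 0 p j) == (nth 0 s (f i) < nth 0 s (f j))]].

Definition avoids s (P : seq (seq nat)) : bool :=
  all (fun p => ~~ contains s p) P.

End Words.

Section Diamonds.
Variables v d : nat.

(* Vertices are numbered in reading order: 0 is the least element, v.-1 the
   greatest one, and the others are the middle elements from left to right. *)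
Definition diamond_lt (i j : 'I_v) : bool :=
  [|| (i == 0 :> nat) && (0 < j) | (i < v.-1) && (j == v.-1 :> nat)].

(* D (k, i) is the label of vertex i of the k-th diamond, minus one. *)
Definition labelling := {ffun 'I_d * 'I_v -> 'I_(v * d)}.

Definition label (D : labelling) (k : 'I_d) (i : 'I_v) : nat := (D (k, i)).+1.

Definition diamonds : {set labelling} :=
  [set D : labelling | injectiveb D &
    [forall k, forall i, forall j,
      diamond_lt i j ==> (label D k i < label D k j)]].

Definition reading (D : labelling) : seq nat :=
  [seq label D k i | k <- enum 'I_d, i <- enum 'I_v].

Definition diamonds_avoiding (P : seq (seq nat)) : {set labelling} :=
  [set D in diamonds | avoids (reading D) P].

End Diamonds.

(* Main.v *)
Require Import Defs.
From mathcomp Require Import all_boot all_order all_algebra zify ring.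

(** A word avoiding 132 and 321 is governed by its first value c (values
    counted from 0): the values below c appear in increasing order (321), so do
    those above c (132), and the values below c occupy consecutive positions
    (132 with 0 as its smallest letter). Hence the word is either increasing or
    c, ..., c + k - 1, 0, ..., c - 1, k + c, ..., n - 1 with k, c > 0, which has
    a single descent. Since 0 is at position k, the diamond inequalities hold
    iff v divides k. Counting the c with k + c <= vd for each k = vj leaves
    v * 'C(d, 2) words with one descent, so the coefficient of y^d is
    1 + v * 'C(d, 2) * x. *)

Set Implicit Arguments.
Unset Strict Implicit.
Unset Printing Implicit Defensive.

Import GRing.Theory.
Local Open Scope ring_scope.

(** * Series of binomial coefficients *)

Section BinomialSeries.
Variable R : comNzRingType.
Implicit Types f g : fps R.

Lemma fps_coefB f g n : fps_coef (f - g) n = fps_coef f n - fps_coef g n.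
Proof. by []. Qed.

Lemma fps_coefD f g n : fps_coef (f + g) n = fps_coef f n + fps_coef g n.
Proof. by []. Qed.

Lemma coefCM a f n : fps_coef (fpsC a * f) n = a * fps_coef f n.
Proof.
by rewrite /= big_ord_recl subn0 big1 ?addr0 // => i _; rewrite mul0r.
Qed.

Lemma coefYM f n :
  fps_coef (fpsY R * f) n = if n is m.+1 then fps_coef f m else 0.
Proof.
case: n => [|n] /=; first by rewrite big_ord1 mul0r.
rewrite !big_ord_recl /= mul0r add0r mul1r subn1 /= big1 ?addr0 // => i _.
by rewrite mul0r.
Qed.

(** This is y^m / (1 - y)^(m + 1), as the multiplied-out identities below imply. *)
Definition binom_series m : fps R := Fps (fun n => 'C(n, m)%:R).

Lemma binom_series0 : (1 - fpsY R) * binom_series 0 = 1.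
Proof.
apply/fpsP => n; rewrite mulrBl mul1r fps_coefB coefYM.
by case: n => [|n] /=; rewrite !bin0 ?subr0 ?subrr.
Qed.

(** Pascal's rule, read coefficientwise. *)
Lemma binom_seriesS m :
  (1 - fpsY R) * binom_series m.+1 = fpsY R * binom_series m.
Proof.
apply/fpsP => n; rewrite mulrBl mul1r fps_coefB !coefYM.
by case: n => [|n] /=; rewrite ?bin0n ?subr0 // binS natrD addrAC subrr add0r.
Qed.

Lemma binom_series2 : (1 - fpsY R) ^+ 3 * binom_series 2 = fpsY R ^+ 2.
Proof.
have -> b : (1 - fpsY R) ^+ 3 * b = (1 - fpsY R) ^+ 2 * ((1 - fpsY R) * b) by ring.
rewrite binom_seriesS mulrCA expr2 -mulrA binom_seriesS [_ * (fpsY R * _)]mulrCA.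
by rewrite binom_series0 mulr1.
Qed.

End BinomialSeries.

Local Open Scope nat_scope.

(** * Counting and ranks in finite ordinals *)

Lemma card_ord_itv n a b : #|[set p : 'I_n | a <= p < b]| = minn n b - a.
Proof.
rewrite -sum1_card (eq_bigl (fun p : 'I_n => a <= p < b)); last first.
  by move=> p; rewrite inE.
rewrite -(big_mkord (fun p => a <= p < b) (fun=> 1)).
elim: n => [|n IHn]; first by rewrite big_geq // min0n sub0n.
by rewrite big_mkcond big_nat_recr //= -big_mkcond IHn; case: ifP; lia.
Qed.

(** An injection of a finite set into itself is onto, so [f] maps this set bijectively onto the
    values below [m]. *)
Lemma card_inj_lt n (f : 'I_n -> 'I_n) m : injective f -> m <= n ->
  #|[set p | f p < m]| = m.
Proof.
move=> fI mn; rewrite -(card_imset _ fI).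
transitivity #|[set q : 'I_n | 0 <= q < m]|; last by rewrite card_ord_itv; lia.
apply: eq_card => q; rewrite inE; apply/imsetP/idP => [[r]|qm].
  by rewrite inE => rm ->.
by exists (invF fI q); rewrite ?inE f_invF.
Qed.

(* Both values are the number of indices with a smaller image. *)
Lemma eq_inj_ord n (f g : 'I_n -> 'I_n) : injective f -> injective g ->
  (forall p q : 'I_n, p < q -> (f p < f q) = (g p < g q)) -> f =1 g.
Proof.
move=> fI gI fg p.
have rank (h : 'I_n -> 'I_n) : injective h -> h p = #|[set q | h q < h p]| :> nat.
  by move=> hI; rewrite card_inj_lt //; exact: ltnW.
apply: val_inj; rewrite /= (rank f) // (rank g) //; apply: eq_card => q.
rewrite !inE; have [/fg // | pq | /ord_inj -> ] := ltngtP q p; last by rewrite !ltnn.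
have neq (h : 'I_n -> 'I_n) : injective h -> h p <> h q :> nat.
  by move=> hI /ord_inj /hI pq'; rewrite pq' ltnn in pq.
by have := neq f fI; have := neq g gI; have := fg _ _ pq; lia.
Qed.

(** * Classification of words avoiding 132 and 321 *)

(** One-line form: c, ..., c + k - 1, then 0, ..., c - 1, then fixed points; if [k] or [c] is 0,
    this is the identity. *)
Definition swap_prefix k c p :=
  if p < k then p + c else if p < k + c then p - k else p.

Lemma swap_prefix00 p : swap_prefix 0 0 p = p.
Proof. by rewrite /swap_prefix addn0 ltn0. Qed.

Lemma swap_prefix_lt n k c p : k + c <= n -> p < n -> swap_prefix k c p < n.
Proof. by rewrite /swap_prefix => kc pn; repeat case: ifP; lia. Qed.

Lemma swap_prefix_inj k c : injective (swap_prefix k c).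
Proof. by move=> p q; rewrite /swap_prefix; repeat case: ifP; lia. Qed.

(** [c] is the first value and [k] the position of 0. The clause on positivity leaves 0, 0 as the
    only parameters of the identity. *)
Lemma swap_prefixE n (f : 'I_n -> 'I_n) : injective f ->
  (forall a b c : 'I_n, a < b -> b < c -> ~~ (f a < f c < f b)) ->
  (forall a b c : 'I_n, a < b -> b < c -> ~~ (f c < f b < f a)) ->
  exists k c, [/\ (0 < k) = (0 < c), k + c <= n &
    forall p, f p = swap_prefix k c p :> nat].
Proof.
case: n f => [f _ _ _|n f fI f132 f321].
  by exists 0, 0; split=> // -[].
have fN (p q : 'I_n.+1) : p < q -> f p <> f q :> nat.
  by move=> pq /ord_inj/fI pq'; rewrite pq' ltnn in pq.
pose c := f ord0; pose k : 'I_n.+1 := invF fI ord0.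
have fk : f k = 0 :> nat by rewrite f_invF.
have f0 : f ord0 = c :> nat by [].
(* A leading 0 plays the 1 of a 132 with any later inversion, so the word increases. *)
have [c0|c_gt0] := posnP c.
  exists 0, 0; split=> // p.
  suff -> : f p = p by rewrite swap_prefix00.
  apply: (@eq_inj_ord _ f id) => // q r qr; rewrite qr.
  have := fN _ _ qr; have := f132 ord0 q r; have := fN ord0 r.
  have [q0|q0] := posnP q; last by move=> /= ???; lia.
  have -> : q = ord0 by exact: val_inj.
  by move=> /=; lia.
have k_gt0 : 0 < k.
  case: (posnP k) => // k0; move: fk.
  have -> : k = ord0 by exact: val_inj.
  by lia.
pose S := [set p : 'I_n.+1 | f p < c].
have cardS : #|S| = c. by apply: card_inj_lt => //; exact: ltnW.
(* A nonzero value below [c] placed before the 0 would give 321 with the leading [c] and that 0. *)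
have S_ge (p : 'I_n.+1) : p \in S -> k <= p.
  rewrite inE => pc; rewrite leqNgt; apply/negP => pk.
  have p0 : 0 < p.
    case: (posnP p) => // p0; move: pc.
    have -> : p = ord0 by exact: val_inj.
    by lia.
  by have := f321 ord0 p k p0 pk; have := fN _ _ pk; lia.
(* A value at least [c] between the 0 and a value below [c] would give 132. *)
have S_itv (p q : 'I_n.+1) : p \in S -> k <= q <= p -> q \in S.
  rewrite !inE => pc kqp; apply/negPn/negP => qc.
  have kq : k < q.
    rewrite ltn_neqAle; case/andP: kqp => -> _; rewrite andbT.
    by apply/eqP => /ord_inj kq; rewrite -kq fk in qc; lia.
  have qp : q < p.
    rewrite ltn_neqAle; case/andP: kqp => _ ->; rewrite andbT.
    by apply/eqP => /ord_inj qp; rewrite qp in qc; lia.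
  by have := f132 k q p kq qp; have := fN _ _ (ltn_trans kq qp); lia.
(* If [p] is in [S], so are all positions from [k] to [p]; as [S] has [c] elements, p < k + c. *)
have subS : S \subset [set p : 'I_n.+1 | k <= p < k + c].
  apply/subsetP => p pS; rewrite inE S_ge //=.
  have : [set q : 'I_n.+1 | k <= q < p.+1] \subset S.
    by apply/subsetP => q; rewrite inE ltnS; exact: S_itv.
  move/subset_leq_card; rewrite card_ord_itv cardS.
  by have := ltn_ord p; have := S_ge p pS; lia.
have kcn : k + c <= n.+1.
  by have := subset_leq_card subS; rewrite card_ord_itv cardS; lia.
have eqS : S = [set p : 'I_n.+1 | k <= p < k + c].
  by apply/eqP; rewrite eqEcard subS card_ord_itv cardS; lia.
have f_small (p : 'I_n.+1) : (f p < c) = (k <= p < k + c).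
  by move/setP/(_ p): eqS; rewrite !inE.
exists k, c; split; rewrite ?k_gt0 ?c_gt0 // => p.
pose g (p : 'I_n.+1) := Ordinal (swap_prefix_lt kcn (ltn_ord p)).
suff -> : f p = g p by [].
(* With the leading [c], 321 orders the values below [c] and 132 those above; [f_small] decides the
   mixed pairs. *)
apply: eq_inj_ord => // [q r /(congr1 val)/swap_prefix_inj/ord_inj //|q r qr].
have -> : (g q < g r) = (swap_prefix k c q < swap_prefix k c r) by [].
have := f_small q; have := f_small r; have := fN _ _ qr.
have := f132 ord0 q r; have := f321 ord0 q r; have := fN ord0 r; have := fN ord0 q.
rewrite /swap_prefix f0 /=.
have [q0|q0] := posnP q.
  have -> : q = ord0 by exact: val_inj.
  by move=> /=; repeat case: ifP; lia.
by repeat case: ifP; lia.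
Qed.

(** * Patterns of length three and descents *)

Lemma not_contains3 s x y z : ~~ contains s [:: x; y; z] ->
  forall a b c, a < b -> b < c -> c < size s ->
  ~~ [&& (x < y) == (nth 0 s a < nth 0 s b), (y < x) == (nth 0 s b < nth 0 s a),
     (x < z) == (nth 0 s a < nth 0 s c), (z < x) == (nth 0 s c < nth 0 s a),
     (y < z) == (nth 0 s b < nth 0 s c) & (z < y) == (nth 0 s c < nth 0 s b)].
Proof.
move=> nc a b c ab bc cs; apply: contra nc => /and5P[h1 h2 h3 h4 /andP[h5 h6]].
have bs := ltn_trans bc cs; have as' := ltn_trans ab bs.
pose t := [:: Ordinal as'; Ordinal bs; Ordinal cs].
apply/existsP; exists [ffun i : 'I_3 => nth (Ordinal as') t i].
apply/andP; split; apply/forallP => -[[|[|[|?]]] hi] //=; apply/forallP.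
all: case=> [[|[|[|?]]] hj] //=; rewrite !ffunE /= ?ltnn //.
all: by rewrite ?(ltn_trans ab bc).
Qed.

(** These three comparisons suffice to recognise 132, and 321 when the letters are distinct. *)
Lemma contains3 s x y z : contains s [:: x; y; z] ->
  exists a b c, [/\ a < b, b < c & c < size s] /\
  [/\ (x < y) = (nth 0 s a < nth 0 s b), (x < z) = (nth 0 s a < nth 0 s c) &
     (z < y) = (nth 0 s c < nth 0 s b)].
Proof.
case/existsP => f /andP[/forallP fm /forallP fp].
pose i0 : 'I_3 := ord0; pose i1 : 'I_3 := Ordinal (isT : 1 < 3).
pose i2 : 'I_3 := Ordinal (isT : 2 < 3).
exists (f i0), (f i1), (f i2); split; split=> //.
- exact: (implyP (forallP (fm i0) i1)).
- exact: (implyP (forallP (fm i1) i2)).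
- exact: eqP (forallP (fp i0) i1).
- exact: eqP (forallP (fp i0) i2).
- exact: eqP (forallP (fp i2) i1).
Qed.

(** Every inversion goes from the first block to the second. A letter before it is also in the first
    block, so the three letters form 231. *)
Lemma swap_prefix_avoids k c s :
  (forall p, p < size s -> nth 0 s p = (swap_prefix k c p).+1) ->
  avoids s [:: [:: 1; 3; 2]; [:: 3; 2; 1]].
Proof.
move=> sE; rewrite /avoids /= andbT; apply/andP; split; apply/negP.
all: case/contains3 => a [b] [e] [[ab be es]]; rewrite !sE; try lia.
all: by rewrite /swap_prefix => -[]; repeat case: ifP; lia.
Qed.

Lemma des0 s : (forall i, i.+1 < size s -> nth 0 s i <= nth 0 s i.+1) -> des s = 0.
Proof.
move=> sm; apply/eqP; rewrite cards_eq0; apply/eqP/setP => i; rewrite !inE.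
by have := sm i; have := ltn_ord i; lia.
Qed.

Lemma des1 s m : m.+1 < size s ->
  (forall i, i.+1 < size s -> (nth 0 s i.+1 < nth 0 s i) = (i == m)) -> des s = 1.
Proof.
move=> ms sm; have ms' : m < (size s).-1 by lia.
rewrite /des -(cards1 (Ordinal ms')); apply: eq_card => i; rewrite !inE.
by rewrite sm -?val_eqE //; have := ltn_ord i; lia.
Qed.

Lemma nth_allpairs (S T U : Type) (F : S -> T -> U) x0 y0 z0 s t k i :
  k < size s -> i < size t ->
  nth z0 [seq F x y | x <- s, y <- t] (k * size t + i) = F (nth x0 s k) (nth y0 t i).
Proof.
elim: s k => [//|x s IHs] [|k] /= ks it.
  by rewrite nth_cat size_map it (nth_map y0).
rewrite nth_cat size_map mulSn -addnA ltnNge leq_addr /= addKn; exact: IHs.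
Qed.

(** * Labellings and their reading words *)

Section Diamonds.
Variables v d : nat.
Implicit Types D : labelling v d.

Lemma pos_proof (ki : 'I_d * 'I_v) : ki.1 * v + ki.2 < v * d.
Proof. by case: ki => [[k kd] [i iv]] /=; nia. Qed.

Definition pos ki : 'I_(v * d) := Ordinal (pos_proof ki).

(** Boolean equality lets [xchoose] extract the preimage in [unpos]. *)
Lemma pos_surj (p : 'I_(v * d)) : exists ki, pos ki == p.
Proof.
have pn := ltn_ord p; have v_gt0 : 0 < v by nia.
have kd : p %/ v < d by rewrite ltn_divLR //; lia.
exists (Ordinal kd, Ordinal (ltn_pmod p v_gt0)).
by apply/eqP/val_inj => /=; rewrite -divn_eq.
Qed.

Definition unpos p := xchoose (pos_surj p).

Lemma unposK : cancel unpos pos.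
Proof. by move=> p; apply/eqP/(xchooseP (pos_surj p)). Qed.

Lemma pos_inj : injective pos.
Proof.
move=> [[k kd] [i iv]] [[l ld] [j jv]] /(congr1 val) /= e.
have v_gt0 : 0 < v by lia.
have kl : k = l by move/(congr1 (divn^~ v)): e; rewrite !divnMDl // !divn_small ?addn0.
have ij : i = j by rewrite kl in e; lia.
by congr (_, _); apply: val_inj.
Qed.

Lemma posK : cancel pos unpos.
Proof. by move=> ki; apply: pos_inj; rewrite unposK. Qed.

Lemma size_reading D : size (reading D) = v * d.
Proof. by rewrite size_allpairs !size_enum_ord mulnC. Qed.

Lemma nth_reading D ki : nth 0 (reading D) (pos ki) = (D ki).+1.
Proof.
case: ki => k i /=; have := @nth_allpairs _ _ _ (label D) k i 0 (enum 'I_d) (enum 'I_v) k i.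
by rewrite !size_enum_ord !nth_ord_enum; apply.
Qed.

(** [insubd] makes this total in [k] and [c]; the values stay in range when k + c <= v * d. *)
Definition swap_labelling k c : labelling v d :=
  [ffun ki => insubd (pos ki) (swap_prefix k c (pos ki))].

Lemma swap_labellingE k c ki : k + c <= v * d ->
  swap_labelling k c ki = swap_prefix k c (pos ki) :> nat.
Proof.
by move=> kc; rewrite ffunE val_insubd (swap_prefix_lt kc) //; exact: ltn_ord.
Qed.

Lemma nth_reading_swap k c p : k + c <= v * d -> p < v * d ->
  nth 0 (reading (swap_labelling k c)) p = (swap_prefix k c p).+1.
Proof.
move=> kc pn; have /(congr1 val) /= <- := unposK (Ordinal pn).
by rewrite (nth_reading _ (unpos _)) swap_labellingE.
Qed.

Lemma des_swap0 : des (reading (swap_labelling 0 0)) = 0.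
Proof.
apply: des0 => i; rewrite size_reading => isz; rewrite !nth_reading_swap //;
  rewrite ?swap_prefix00; lia.
Qed.

Lemma des_swap k c : 0 < k -> 0 < c -> k + c <= v * d ->
  des (reading (swap_labelling k c)) = 1.
Proof.
(* The descent is at the end of the first block, where c + k - 1 is followed by 0. *)
move=> k0 c0 kc; apply: (@des1 _ k.-1); first by rewrite size_reading; lia.
move=> i; rewrite size_reading => isz; rewrite !nth_reading_swap //; try lia.
by rewrite /swap_prefix; repeat case: ifP; lia.
Qed.

Lemma swap_labelling_avoiding j c : v * j + c <= v * d ->
  swap_labelling (v * j) c \in
    diamonds_avoiding v d [:: [:: 1; 3; 2]; [:: 3; 2; 1]].
Proof.
move=> jc; rewrite !inE; apply/andP; split; last first.
  apply: (@swap_prefix_avoids (v * j) c) => p; rewrite size_reading.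
  exact: nth_reading_swap.
apply/andP; split.
  apply/injectiveP => p q /(congr1 val); rewrite /= !swap_labellingE //.
  by move/swap_prefix_inj/ord_inj/pos_inj.
apply/forallP => k; apply/forallP => a; apply/forallP => b; apply/implyP.
rewrite /label !swap_labellingE // /= /diamond_lt => hab.
have ab : a < b by have := ltn_ord b; lia.
(* As [v] divides v * j, no diamond straddles the end of the first block, and [swap_prefix]
   increases on either side of it. *)
have blk : (k * v + a < v * j) = (k * v + b < v * j).
  by have := ltn_ord b; case: (ltnP k j) => kj; nia.
by rewrite /swap_prefix blk; repeat case: ifP; lia.
Qed.

Lemma diamonds_avoidingP D : 3 < v ->
  D \in diamonds_avoiding v d [:: [:: 1; 3; 2]; [:: 3; 2; 1]] ->
  D = swap_labelling 0 0 \/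
  exists j c, [/\ 0 < j, 0 < c, v * j + c <= v * d & D = swap_labelling (v * j) c].
Proof.
move=> v_gt3; rewrite !inE => /andP[/andP[/injectiveP DI Dlt]].
rewrite /avoids /= andbT => /andP[/not_contains3 n132 /not_contains3 n321].
pose f (p : 'I_(v * d)) : 'I_(v * d) := D (unpos p).
have fE (p : 'I_(v * d)) : nth 0 (reading D) p = (f p).+1.
  by rewrite -[in LHS](unposK p) nth_reading.
have fI : injective f := inj_comp DI (can_inj unposK).
have [a b c ab bc|a b c ab bc|k [c [kc0 kcn fkc]]] := swap_prefixE fI.
- have := n132 a b c ab bc; rewrite size_reading !fE => /(_ (ltn_ord c)).
  by lia.
- have := n321 a b c ab bc; rewrite size_reading !fE => /(_ (ltn_ord c)).
  by lia.
have DE : D = swap_labelling k c.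
  apply/ffunP => ki; apply: val_inj; rewrite /= swap_labellingE //.
  by rewrite -fkc /f posK.
have [k0|k_gt0] := posnP k.
  by left; rewrite DE k0; congr swap_labelling; lia.
right; have v_gt0 : 0 < v by lia.
have c_gt0 : 0 < c by lia.
(* Otherwise the smallest label, at position [k], would lie above the least vertex of diamond
   [k %/ v]. *)
suff r0 : k %% v = 0.
  exists (k %/ v), c; have kE : v * (k %/ v) = k by have := divn_eq k v; lia.
  by rewrite kE; split=> //; nia.
apply/eqP; rewrite -leqn0 leqNgt; apply/negP => r_gt0.
have qd : k %/ v < d by rewrite ltn_divLR //; lia.
have := Dlt; move/forallP/(_ (Ordinal qd))/forallP/(_ (Ordinal v_gt0)).
move/forallP/(_ (Ordinal (ltn_pmod k v_gt0))); rewrite /diamond_lt /= r_gt0 /=.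
rewrite /label DE !swap_labellingE //= addn0 -divn_eq.
have lt_k : k %/ v * v < k by have := divn_eq k v; lia.
have k_kc : k < k + c by lia.
by rewrite /swap_prefix lt_k ltnn k_kc subnn ltnS ltn0.
Qed.

(** * Counting the words with one descent *)

(* The pair (l, c) encodes the word with k = v * (d - l) and first value c + 1
   (see swap_of); counting diamonds from the right makes the bound on c linear
   in l. *)
Definition swaps : {set 'I_d * 'I_(v * d)} :=
  [set lc : 'I_d * 'I_(v * d) | lc.2 < v * lc.1].

(** Each [l] admits v * l values of [c], and the [l] below [d] sum to 'C(d, 2). *)
Lemma card_swaps : #|swaps| = v * 'C(d, 2).
Proof.
rewrite -sum1_card (eq_bigl (fun lc : 'I_d * 'I_(v * d) => true && (lc.2 < v * lc.1))); last first.
  by move=> lc; rewrite inE.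
rewrite -(pair_big_dep xpredT (fun (l : 'I_d) (c : 'I_(v * d)) => c < v * l) (fun _ _ => 1)) /=.
rewrite -bin2_sum big_mkord big_distrr /=; apply: eq_bigr => l _.
rewrite sum1_card -[LHS]cardsE.
transitivity #|[set c : 'I_(v * d) | 0 <= c < v * l]|; first by [].
by rewrite card_ord_itv; have := ltn_ord l; nia.
Qed.

Definition swap_of (lc : 'I_d * 'I_(v * d)) : labelling v d :=
  swap_labelling (v * (d - lc.1)) lc.2.+1.

Lemma swapsP lc : lc \in swaps ->
  0 < v * (d - lc.1) /\ v * (d - lc.1) + lc.2.+1 <= v * d.
Proof.
rewrite inE; case: lc => l c /= cl; have := ltn_ord l; have := ltn_ord c; nia.
Qed.

(** The first letter determines [c], and the position of the smallest label determines v * (d - l),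
    hence [l]. *)
Lemma swap_of_inj : {in swaps &, injective swap_of}.
Proof.
move=> [l c] [l' c'] /swapsP /= [k0 kc] /swapsP /= [k0' kc'] e.
have n_gt0 : 0 < v * d by lia.
have kn : v * (d - l) < v * d by lia.
have nthE p := congr1 (fun D => nth 0 (reading D) p) e.
have := nthE 0; have := nthE (v * (d - l)).
rewrite /swap_of !nth_reading_swap // /swap_prefix /= k0 k0' ltnn => e1 e2.
have -> : c = c' by apply: val_inj => /=; lia.
suff -> : l = l' by [].
have ek : v * (d - l) = v * (d - l').
  by move: (v * (d - l)) (v * (d - l')) e1 k0 => k k'; repeat case: ifP; lia.
have : d - l = d - l' by apply/eqP; rewrite -(@eqn_pmul2l v) ?ek //; nia.
by move=> el; apply: val_inj => /=; have := ltn_ord l; have := ltn_ord l'; lia.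
Qed.

Lemma diamonds_avoidingE : 3 < v ->
  diamonds_avoiding v d [:: [:: 1; 3; 2]; [:: 3; 2; 1]] =
  swap_labelling 0 0 |: swap_of @: swaps.
Proof.
move=> v_gt3; apply/setP => D; rewrite in_setU1; apply/idP/orP.
  case/(diamonds_avoidingP v_gt3) => [->|[j [c [j0 c0 jc ->]]]]; [by left | right].
  (* The code of the pair j, c is l = d - j together with c - 1. *)
  have ld : d - j < d by nia.
  have cn : c.-1 < v * d by lia.
  apply/imsetP; exists (Ordinal ld, Ordinal cn); first by rewrite inE /=; nia.
  by rewrite /swap_of /=; congr swap_labelling; [congr muln; nia | lia].
case=> [/eqP->|/imsetP[lc /swapsP[_ kc] ->]]; last exact: swap_labelling_avoiding.
by have := @swap_labelling_avoiding 0 0; rewrite muln0; apply; lia.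
Qed.

(** The number of descents, 0 against 1, separates them. *)
Lemma swap0_notin : swap_labelling 0 0 \notin swap_of @: swaps.
Proof.
apply/imsetP => -[lc /swapsP[k0 kc]] /(congr1 (fun D => des (reading D))).
by rewrite des_swap0 des_swap.
Qed.

Lemma sum_des_avoiding : 3 < v ->
  (\sum_(D in diamonds_avoiding v d [:: [:: 1; 3; 2]; [:: 3; 2; 1]])
     'X^(des (reading D)) = 1 + (v * 'C(d, 2))%:R * 'X :> {poly int})%R.
Proof.
move=> v_gt3; rewrite diamonds_avoidingE // big_setU1 ?swap0_notin //=.
rewrite des_swap0 expr0 big_imset /=; last exact: swap_of_inj.
rewrite -card_swaps mulr_natl -sumr_const; congr (_ + _)%R.
by apply: eq_bigr => lc /swapsP[k0 kc]; rewrite des_swap.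
Qed.

End Diamonds.

(** * The generating function *)

Local Open Scope ring_scope.

Theorem theorem3p8 (v : nat) (hv : (4 <= v)%N) :
  let x : fps {poly int} := fpsC 'X in
  let y : fps {poly int} := fpsY {poly int} in
  1 + Fps (fun d => if d is 0%N then 0 else
        \sum_(D in diamonds_avoiding v d [:: [:: 1; 3; 2]%N; [:: 3; 2; 1]%N])
           'X^(des (reading D)))
  = (1 - 2 * y + y ^+ 2 + v%:R * x * y ^+ 2) / (1 - y) ^+ 3.
Proof.
move=> x y; set F := LHS.
have uy : (1 - y) ^+ 3 \is a GRing.unit.
  by rewrite unitrX //; apply/unitrP; exists (binom_series _ 0); rewrite mulrC !binom_series0.
(* The coefficient at 0 is the separate 1; the others come from [sum_des_avoiding]. *)
have FE : F = binom_series _ 0 + (v%:R * x) * binom_series _ 2.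
  have -> : v%:R * x = fpsC (v%:R * 'X).
    apply/fpsP => n; rewrite mulr_natl.
    elim: (v) => [|m IHm]; first by rewrite mulr0n mul0r /=; case: eqP.
    by rewrite mulrSr -natr1 mulrDl mul1r /= IHm /=; case: eqP; rewrite ?addr0.
  apply/fpsP => -[|n]; rewrite !fps_coefD coefCM /=.
    by rewrite bin0n mulr0.
  by rewrite add0r sum_des_avoiding // bin0 natrM mulrAC.
apply: (canRL (mulrK uy)); rewrite FE.
(* This grouping leaves the numerator (1 - y)^2 + v x y^2. *)
have -> (b0 b2 : fps {poly int}) : (b0 + v%:R * x * b2) * (1 - y) ^+ 3 =
    (1 - y) ^+ 2 * ((1 - y) * b0) + v%:R * x * ((1 - y) ^+ 3 * b2) by ring.
by rewrite binom_series0 binom_series2 -/y; ring.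
Qed.
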